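(* Let $K, M, N, L$ be positive integers, let $M_{\mathrm{tot}} = KM$, and let $\sigma^2>0$. For each $n \in \{1,\dots,N\}$ let $\epsilon_n\in(0,1)$ and let $\mathbf{R}_n=\mathrm{bdiag}(\mathbf{R}_{1n},\dots,\mathbf{R}_{Kn})\in\mathbb{C}^{M_{\mathrm{tot}}\times M_{\mathrm{tot}}}$ be block-diagonal, where each $\mathbf{R}_{kn}\in\mathbb{C}^{M\times M}$ is Hermitian positive semidefinite. Let $\mathbf{x}_n = a_n\mathbf{h}_n$ with $a_n\sim\mathrm{Bernoulli}(\epsilon_n)$ and $\mathbf{h}_n\sim\mathcal{CN}(\mathbf{0},\mathbf{R}_n)$ independent. Define the state evolution with the MMSE denoiser as follows: $$\bm{\Sigma}^0=\sigma^2\mathbf{I}+\frac{1}{L}\sum_{n=1}^N \mathbf{R}_n,$$ and for $t\ge 0$, $$\bm{\Sigma}^{t+1}=\sigma^2\mathbf{I}+\frac{1}{L}\sum_{n=1}^N\mathbb{E}\Big[\big(\mathbf{g}_{t,n}(\mathbf{x}_n+\mathbf{v}^t)-\mathbf{x}_n\big)\big(\mathbf{g}_{t,n}(\mathbf{x}_n+\mathbf{v}^t)-\mathbf{x}_n\big)^H\Big],$$ where $\mathbf{v}^t\sim\mathcal{CN}(\mathbf{0},\bm{\Sigma}^t)$ is independent of $\mathbf{x}_n$, and $\mathbf{g}_{t,n}(\bm{\xi})=\mathbb{E}[\mathbf{x}_n\mid \mathbf{x}_n+\mathbf{v}^t=\bm{\xi}]$ is the MMSE denoiser, explicitly $$\mathbf{g}_{t,n}(\bm{\xi})=\Big(1+\tfrac{1-\epsilon_n}{\epsilon_n}\tfrac{|\mathbf{R}_n+\bm{\Sigma}^t|}{|\bm{\Sigma}^t|}\exp\big(-\bm{\xi}^H\bm{\Omega}_n^t\bm{\xi}\big)\Big)^{-1}\mathbf{R}_n(\mathbf{R}_n+\bm{\Sigma}^t)^{-1}\bm{\xi},\qquad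 \bm{\Omega}_n^t=(\bm{\Sigma}^t)^{-1}-(\mathbf{R}_n+\bm{\Sigma}^t)^{-1},$$ with $|\cdot|$ denoting the determinant. Then for every $t\ge 0$, $\bm{\Sigma}^t$ is block-diagonal with the same block structure, i.e., $\bm{\Sigma}^t=\mathrm{bdiag}(\bm{\Sigma}^t_1,\dots,\bm{\Sigma}^t_K)$ with $\bm{\Sigma}^t_k\in\mathbb{C}^{M\times M}$.
   Context: $\mathrm{bdiag}(\mathbf{A}_1,\dots,\mathbf{A}_K)$ denotes the block-diagonal matrix with diagonal blocks $\mathbf{A}_1,\dots,\mathbf{A}_K$. $\mathcal{CN}(\mathbf{0},\mathbf{C})$ denotes the circularly-symmetric complex Gaussian distribution with covariance $\mathbf{C}$. The expectation in the state evolution is over the joint distribution of $\mathbf{x}_n$ and $\mathbf{v}^t$; $(\cdot)^H$ is the conjugate transpose. *)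

(* Defs.v *)
From mathcomp Require Import all_boot all_order all_algebra.
From mathcomp Require Import all_classical all_reals all_analysis.
From mathcomp Require Import complex.

Set Implicit Arguments.
Unset Strict Implicit.
Unset Printing Implicit Defensive.

Import Order.TTheory GRing.Theory Num.Theory.
Local Open Scope ring_scope.
Local Open Scope complex_scope.

Definition conjT (R : realFieldType) m n (A : 'M[R[i]]_(m, n)) : 'M[R[i]]_(n, m) :=
  (map_mx (@conjc R) A)^T.

Definition hermitian (R : realFieldType) n (A : 'M[R[i]]_n) : Prop :=
  conjT A = A.

(* Hermitian positive semidefinite: A^H = A and u^H A u >= 0 for all u
   (u^H A u is real for Hermitian A, we require its real part to be >= 0). *)
Definition psd (R : realFieldType) n (A : 'M[R[i]]_n) : Prop :=
  hermitian A /\ forall u : 'cV[R[i]]_n, 0 <= complex.Re ((conjT u *m A *m u) 0 0).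

Lemma blk_lt (K M : nat) (i : 'I_(K * M)) : (i %/ M < K)%N.
Proof.
case: M i => [|M] i; first by case: i => i; rewrite muln0.
by rewrite ltn_divLR // ltn_ord.
Qed.

Lemma ofs_lt (K M : nat) (i : 'I_(K * M)) : (i %% M < M)%N.
Proof.
case: M i => [|M] i; first by case: i => i; rewrite muln0.
by rewrite ltn_mod.
Qed.

Definition blk (K M : nat) (i : 'I_(K * M)) : 'I_K := Ordinal (blk_lt i).
Definition ofs (K M : nat) (i : 'I_(K * M)) : 'I_M := Ordinal (ofs_lt i).

Definition bdiag (R : pzRingType) (K M : nat) (B : 'I_K -> 'M[R]_M) : 'M[R]_(K * M) :=
  \matrix_(i, j) (if blk i == blk j then B (blk i) (ofs i) (ofs j) else 0).

Section Expect.
Context {d : measure_display} {T : measurableType d} {R : realType}.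

Definition cexpect (P : probability T R) (f : T -> R[i]) : R[i] :=
  (Rintegral P setT (fun w => complex.Re (f w))) +i*
  (Rintegral P setT (fun w => complex.Im (f w))).

Definition mexpect (P : probability T R) m n (F : T -> 'M[R[i]]_(m, n))
  : 'M[R[i]]_(m, n) := \matrix_(i, j) cexpect P (fun w => F w i j).

Definition expi (theta : R) : R[i] := cos theta +i* sin theta.

Definition cvec_measurable n (X : T -> 'cV[R[i]]_n) : Prop :=
  forall i : 'I_n,
    measurable_fun setT (fun w => complex.Re (X w i 0)) /\
    measurable_fun setT (fun w => complex.Im (X w i 0)).

End Expect.

(* Re(u^H x) : the real pairing used in characteristic functions on C^n *)
Definition rpair (R : realFieldType) n (u x : 'cV[R[i]]_n) : R :=
  complex.Re ((conjT u *m x) 0 0).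

(* characteristic function of CN(0, C):  E[exp(i Re(u^H h))] = exp(-u^H C u / 4) *)
Definition cgauss_cf (R : realType) n (C : 'M[R[i]]_n) (u : 'cV[R[i]]_n) : R[i] :=
  (expR (- complex.Re ((conjT u *m C *m u) 0 0) / 4))%:C.

Definition bern_cf (R : realType) (eps : R) (s : R) : R[i] :=
  (1 - eps)%:C + eps%:C * expi s.

Definition mmse_denoiser (R : realType) n (eps : R) (Rn S : 'M[R[i]]_n)
  (xi : 'cV[R[i]]_n) : 'cV[R[i]]_n :=
  let Omega := invmx S - invmx (Rn + S) in
  let q := complex.Re ((conjT xi *m Omega *m xi) 0 0) in
  (1 + ((1 - eps) / eps)%:C * (\det (Rn + S) / \det S) * (expR (- q))%:C)^-1
    *: (Rn *m invmx (Rn + S) *m xi).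

(* Main.v *)
(* Flipping the sign of one block of coordinates, D = bdiag(I, .., -I, .., I), preserves the law of
   (a_n, h_n, v^t): by induction Sigma^t is block-diagonal, hence D commutes with both covariances and
   the joint characteristic function is D-invariant. The MMSE denoiser commutes with D, so the error
   covariance E satisfies E = D E D and its entries coupling the flipped block to another one vanish.
   That the characteristic function determines the law is proved without Fourier inversion:
   trigonometric polynomials form an algebra on which the two expectations agree, and bounded pointwise
   limits of such polynomials contain the indicators of a pi-system that generates the sigma-algebra of
   all linear functionals. *)
From HB Require Import structures.
Require Import Defs.
From mathcomp Require Import all_boot all_order all_algebra.
From mathcomp Require Import all_classical all_reals all_analysis.
From mathcomp Require Import measurable_realfun complex ring lra.

Set Implicit Arguments.
Unset Strict Implicit.
Unset Printing Implicit Defensive.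

Import Order.TTheory GRing.Theory Num.Theory.
Import numFieldNormedType.Exports.
Local Open Scope ring_scope.
Local Open Scope classical_set_scope.

(** * Polynomials converging pointwise to a step function on $[0,1]$ *)

Section kuhn.
Context {R : realType}.
Implicit Types (x y u : R) (n : nat).

Lemma bernoulli_ineq x n : -1 <= x -> 1 + n%:R * x <= (1 + x) ^+ n.
Proof.
move=> x1; elim: n => [|n ih]; first by rewrite mul0r addr0 expr0.
have h : (1 + x) * (1 + n%:R * x) <= (1 + x) ^+ n.+1.
  by rewrite exprS ler_wpM2l// -lerBlDl sub0r.
apply: le_trans h; rewrite -natr1 -subr_ge0.
have -> : (1 + x) * (1 + n%:R * x) - (1 + (n%:R + 1) * x) = n%:R * x ^+ 2 by ring.
by rewrite mulr_ge0// sqr_ge0.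
Qed.

(** Bernoulli bounds $1+ny$ by $(1+y)^n$, and $(1-y)^n(1+y)^n=(1-y^2)^n\le 1$. This turns the lower
    bound of Bernoulli into an upper bound for $(1-y)^n$. *)
Lemma onem_expr_mul_le1 y n : 0 <= y <= 1 -> (1 - y) ^+ n * (1 + n%:R * y) <= 1.
Proof.
move=> /andP[y0 y1].
apply: (@le_trans _ _ ((1 - y) ^+ n * (1 + y) ^+ n)).
  apply: ler_wpM2l; first by rewrite exprn_ge0// subr_ge0.
  by apply: bernoulli_ineq; apply: le_trans y0; rewrite oppr_le0.
by rewrite -exprMn; apply: exprn_ile1; nra.
Qed.

(** With $y=\sqrt x$, one factor $y^n$ of $n x^n=y^n\cdot n y^n$ absorbs $n$: the previous bound at
    $1-y$ gives $n y^n\le 1/(1-y)$, and the other factor tends to 0. *)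
Lemma cvg_natrM_expr x : 0 <= x < 1 -> n%:R * x ^+ n @[n --> \oo] --> 0.
Proof.
move=> /andP[x0 x1]; set y := Num.sqrt x.
have y0 : 0 <= y by exact: sqrtr_ge0.
have xy : x = y * y by rewrite -expr2 sqr_sqrtr.
have y1 : y < 1 by rewrite ltNge; apply/negP => h; move: x1; rewrite xy; nra.
have yP : 0 < 1 - y by rewrite subr_gt0.
apply: (@squeeze_cvgr _ _ _ _ (fun=> 0) (fun n => y ^+ n * (1 - y)^-1)).
- near=> n; rewrite mulr_ge0 ?exprn_ge0//=.
  rewrite xy exprMn mulrA [leLHS]mulrC ler_wpM2l ?exprn_ge0//.
  rewrite -[leRHS]mul1r ler_pdivlMr//.
  have := @onem_expr_mul_le1 (1 - y) n; rewrite (_ : 1 - (1 - y) = y); last by ring.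
  have -> : 0 <= 1 - y <= 1 by lra.
  have : 0 <= y ^+ n by rewrite exprn_ge0.
  move=> h /(_ isT) h2; lra.
- exact: cvg_cst.
- rewrite -[X in _ --> X](mul0r (1 - y)^-1).
  by apply: cvgMl; apply: cvg_expr; rewrite ger0_norm.
Unshelve. all: end_near. Qed.

(* Kuhn's polynomials: the exponent n 2^n balances u^n exactly at u = 1/2. *)
Definition kuhn n u := (1 - u ^+ n) ^+ (n * 2 ^ n).

Lemma kuhn_itv n u : 0 <= u <= 1 -> 0 <= kuhn n u <= 1.
Proof.
move=> /andP[u0 u1]; have un : 0 <= u ^+ n <= 1 by rewrite exprn_ge0// exprn_ile1.
by rewrite exprn_ge0 ?exprn_ile1//; lra.
Qed.

(** Below $1/2$, Bernoulli gives the lower bound $1-n(2u)^n\to 1$. From $1/2$ on, $(2u)^n\ge 1$ and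
    the upper bound $1/(1+n(2u)^n)\le 1/(n+1)$ tends to 0; the point $1/2$ itself belongs to this
    case. *)
Lemma kuhn_cvg u : 0 <= u <= 1 -> kuhn n u @[n --> \oo] --> ((u < 2^-1)%R%:R : R).
Proof.
move=> u01; have /andP[u0 u1] := u01.
have un n : 0 <= u ^+ n <= 1 by rewrite exprn_ge0// exprn_ile1.
have mE n : (n * 2 ^ n)%:R * u ^+ n = n%:R * (2 * u) ^+ n.
  by rewrite natrM natrX exprMn mulrA.
have [u2|u2] := ltP.
- apply: (@squeeze_cvgr _ _ _ _ (fun n => 1 - n%:R * (2 * u) ^+ n) (fun=> 1)).
  + near=> n; have /andP[_ ->] := @kuhn_itv n u u01; rewrite andbT -mE.
    rewrite -mulrN; apply: bernoulli_ineq.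
    by have /andP[? ?] := un n; lra.
  + rewrite -[X in _ --> X]subr0; apply: cvgB; first exact: cvg_cst.
    by apply: cvg_natrM_expr; lra.
  + exact: cvg_cst.
- apply: (@squeeze_cvgr _ _ _ _ (fun=> 0) (fun n => harmonic n)); [|exact: cvg_cst|exact: cvg_harmonic].
  near=> n; have /andP[k0 _] := @kuhn_itv n u u01; rewrite k0/=.
  rewrite -[leRHS]mul1r ler_pdivlMr ?ltr0n//.
  apply: le_trans (@onem_expr_mul_le1 _ (n * 2 ^ n) (un n)).
  apply: ler_wpM2l => //; rewrite mE -natr1 addrC lerD2l.
  rewrite -{1}[n%:R]mulr1 ler_wpM2l// exprn_ege1//; lra.
Unshelve. all: end_near. Qed.

End kuhn.

(** * Real trigonometric polynomials and the sets they approximate *)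

Section trigonometric_polynomials.
Context {R : realType} {V : Type}.
Variable Lam : set (V -> R).
Hypothesis Lam_comb : forall (r : R) f g, Lam f -> Lam g -> Lam (fun x => r * f x + g x).

(** The free phase [b] covers sines and constants, so real cosines suffice; the list-like shape
    gives induction on the number of terms. *)
Inductive trigp : (V -> R) -> Prop :=
| trigp0 : trigp (fun=> 0)
| trigpS c b l f : Lam l -> trigp f -> trigp (fun x => c * cos (l x + b) + f x).

Lemma trigpD f g : trigp f -> trigp g -> trigp (fun x => f x + g x).
Proof.
elim=> [|c b l {}f ll _ ih] tg.
  by rewrite (_ : (fun _ => _) = g)//; apply/funext => x; rewrite add0r.
rewrite (_ : (fun _ => _) = (fun x => c * cos (l x + b) + (f x + g x))).
  exact/trigpS/ih.
by apply/funext => x; rewrite addrA.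
Qed.

(** Product-to-sum: $2\cos p\cos q=\cos(p+q)+\cos(p-q)$, and the new frequencies stay in [Lam] by
    [Lam_comb]. *)
Lemma trigp_mul_cos c b l f : Lam l -> trigp f ->
  trigp (fun x => c * cos (l x + b) * f x).
Proof.
move=> ll; elim=> [|c' b' l' {}f ll' _ ih].
  by under eq_fun do rewrite mulr0; exact: trigp0.
rewrite (_ : (fun _ => _) = (fun x =>
    c * c' / 2 * cos ((1 * l x + l' x) + (b + b')) +
    (c * c' / 2 * cos ((-1 * l' x + l x) + (b - b')) +
     c * cos (l x + b) * f x))).
  by apply: trigpS; [exact: Lam_comb|apply: trigpS; [exact: Lam_comb|]].
apply/funext => x.
rewrite (_ : 1 * l x + l' x + (b + b') = (l x + b) + (l' x + b')); last by ring.
rewrite (_ : -1 * l' x + l x + (b - b') = (l x + b) - (l' x + b')); last by ring.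
by move: (l x + b) (l' x + b') => p q; rewrite (cosD p q) (cosB p q); field.
Qed.

Lemma trigpM f g : trigp f -> trigp g -> trigp (fun x => f x * g x).
Proof.
move=> + tg; elim=> [|c b l {}f ll _ ih].
  by under eq_fun do rewrite mul0r; exact: trigp0.
under eq_fun do rewrite mulrDl.
by apply: trigpD => //; exact: trigp_mul_cos.
Qed.

Hypothesis Lam0 : Lam (fun=> 0).

Lemma trigp_cst c : trigp (fun=> c).
Proof.
rewrite (_ : (fun=> c) = (fun x => c * cos ((fun=> 0) x + 0) + (fun=> 0) x)).
  by apply: trigpS => //; exact: trigp0.
by apply/funext => x; rewrite !addr0 cos0 mulr1.
Qed.

Lemma trigp_cos l b : Lam l -> trigp (fun x => cos (l x + b)).
Proof.
move=> ll; rewrite (_ : (fun _ => _) = (fun x => 1 * cos (l x + b) + (fun=> 0) x)).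
  by apply: trigpS => //; exact: trigp0.
by apply/funext => x; rewrite addr0 mul1r.
Qed.

Lemma trigpX f n : trigp f -> trigp (fun x => f x ^+ n).
Proof.
move=> tf; elim: n => [|n ih]; first exact: trigp_cst.
by under eq_fun do rewrite exprS; exact: trigpM.
Qed.

Lemma trigp_kuhn f n : trigp f -> trigp (fun x => kuhn n (f x)).
Proof.
move=> tf; apply: (@trigpX (fun x => 1 - f x ^+ n)).
apply: trigpD; first exact: trigp_cst.
rewrite (_ : (fun _ => _) = (fun x => -1 * f x ^+ n)); last first.
  by apply/funext => x; rewrite mulN1r.
by apply: (@trigpM (fun=> -1)); [exact: trigp_cst|exact: trigpX].
Qed.

(** The bounds 0 and 1 provide the domination for limits under the expectation. They survive
    products, which makes the family a pi-system. *)
Definition trig_set : set (set V) := [set E | exists f : (V -> R)^nat,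
  [/\ forall n, trigp (f n), forall n x, 0 <= f n x <= 1 &
      forall x, f n x @[n --> \oo] --> (\1_E x : R)]].

Lemma trig_setI : setI_closed trig_set.
Proof.
move=> A B [f [tf f01 fA]] [g [tg g01 gB]]; exists (fun n x => f n x * g n x); split.
- by move=> n; exact: trigpM.
- move=> n x; have /andP[? ?] := f01 n x; have /andP[? ?] := g01 n x.
  by rewrite mulr_ge0//= mulr_ile1.
- by move=> x; rewrite indicI; apply: cvgM.
Qed.

Lemma trig_setT : trig_set setT.
Proof.
exists (fun _ _ => 1); split=> [n|n x|x]; first exact: trigp_cst.
- by rewrite ler01 lexx.
- by rewrite indicT; exact: cvg_cst.
Qed.

(** Rescaling the cosine to $u=(1+\cos)/2\in[0,1]$ moves the threshold 0 to $1/2$, where the Kuhn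
    polynomials jump. *)
Lemma trig_set_cos l b : Lam l -> trig_set [set x | cos (l x + b) < 0].
Proof.
move=> ll; pose u x := 2^-1 + 2^-1 * cos (l x + b).
have u01 x : 0 <= u x <= 1.
  by have := cos_geN1 (l x + b); have := cos_le1 (l x + b); rewrite /u; lra.
exists (fun n x => kuhn n (u x)); split.
- move=> n; apply: trigp_kuhn; apply: trigpD; first exact: trigp_cst.
  by apply: trigpM; [exact: trigp_cst|exact: trigp_cos].
- by move=> n x; exact: kuhn_itv.
- move=> x; rewrite indicE.
  rewrite (_ : (x \in _) = (u x < 2^-1)); first exact: kuhn_cvg.
  by apply/idP/idP; rewrite inE/= /u => h; lra.
Qed.

End trigonometric_polynomials.

(** * Uniqueness of the law from the characteristic function *)

Section uniqueness.
Context {R : realType} {V : pointedType}.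
Variable Lam : set (V -> R).
Hypothesis Lam0 : Lam (fun=> 0).
Hypothesis Lam_comb : forall (r : R) f g, Lam f -> Lam g -> Lam (fun x => r * f x + g x).

Local Notation W := (g_sigma_algebraType (trig_set Lam)).

(** The set where $l<c$ is the lower limit of the sets where $\sin((c-l)/(n+1))>0$. A phase shift by
    $\pi/2$ puts each of these in the form $\cos(\cdot)<0$, hence in the generating pi-system. *)
Lemma lam_measurable (l : V -> R) : Lam l -> measurable_fun setT (l : W -> R).
Proof.
move=> ll; apply: (@measurability _ _ W R setT l (@measurable_realfun.RGenInftyO.G R)).
  exact: measurable_realfun.RGenInftyO.measurableE.
move=> _ [_ [c ->] <-]; rewrite setTI.
(* for n large, (c - l x) / n lies in (-pi, pi), where its sign is that of its sine *)
pose S n : set W := [set x : W | cos (- n.+1%:R^-1 * l x + (n.+1%:R^-1 * c + pi / 2)) < 0].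
have SE n x : S n x <-> 0 < sin ((c - l x) / n.+1%:R).
  rewrite /S/= (_ : _ + _ = (c - l x) / n.+1%:R + pi / 2); last by ring.
  by rewrite cosDpihalf oppr_lt0.
have mS n : measurable (S n).
  apply: sub_sigma_algebra.
  apply: (@trig_set_cos _ _ _ Lam_comb Lam0 (fun x => - n.+1%:R^-1 * l x)).
  have -> : (fun x => - n.+1%:R^-1 * l x) = (fun x => - n.+1%:R^-1 * l x + (fun=> 0) x).
    by apply/funext => x; rewrite addr0.
  exact: Lam_comb.
rewrite (_ : _ @^-1` _ = \bigcup_N \bigcap_(n in [set n | (N <= n)%N]) S n).
  by apply: bigcupT_measurable => N; apply: bigcap_measurableType => // n _; exact: mS.
have small (y : R) : exists N : nat, forall n, (N <= n)%N -> `|y| / n.+1%:R < pi.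
  exists (Num.bound (`|y| / pi)) => n Nn; rewrite ltr_pdivrMr// mulrC -ltr_pdivrMr ?pi_gt0//.
  apply: lt_le_trans (archi_boundP _) _; first by rewrite divr_ge0 ?pi_ge0.
  by rewrite ler_nat; apply: leq_trans Nn _.
apply/seteqP; split => [x /=|x [N _ SN]/=]; rewrite in_itv/=.
  move=> lc; have [N hN] := small (c - l x); exists N => // n /= /hN.
  have cl : 0 < c - l x by rewrite subr_gt0.
  rewrite gtr0_norm// => h; apply/SE/sin_gt0_pi.
  by rewrite h divr_gt0.
rewrite ltNge; apply/negP => cl; have [N' hN'] := small (c - l x).
have /SE := SN (maxn N N') (leq_maxl _ _); have := hN' _ (leq_maxr N N').
rewrite ler0_norm ?subr_le0// => h.
rewrite ltNge => /negP; apply.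
rewrite -[(c - l x)]opprK mulNr sinN oppr_le0 sin_ge0_pi//.
by rewrite (ltW h) divr_ge0// oppr_ge0 subr_le0.
Qed.

Context {d} {T : measurableType d} (P : probability T R).

Lemma bounded_fin_integrable (f : T -> R) (M : R) : measurable_fun setT f ->
  (forall w, `|f w| <= M) -> P.-integrable setT (EFin \o f).
Proof.
move=> mf fM; apply: measurable_bounded_integrable => //.
  exact: le_lt_trans (probability_le1 P _) (ltry _).
by exists M; split; [exact: num_real|move=> x Mx w _; apply: le_trans (fM w) (ltW Mx)].
Qed.

Section one_variable.
Variable Y : T -> V.
Hypothesis mY : forall l, Lam l -> measurable_fun setT (l \o Y).

Lemma trigp_comp_integrable f : trigp Lam f ->
  measurable_fun setT (f \o Y) /\ P.-integrable setT (EFin \o (f \o Y)).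
Proof.
move=> tf; suff [mf [M fM]] : measurable_fun setT (f \o Y) /\ exists M, forall x, `|f x| <= M.
  by split; [exact: mf|exact: (bounded_fin_integrable mf (fun w => fM (Y w)))].
elim: tf => [|c b l {}f ll _ [mf [M fM]]].
  by split; [exact: measurable_cst|exists 0 => x; rewrite normr0].
split.
  apply: measurable_funD => //; apply: measurable_funM; first exact: measurable_cst.
  apply: measurableT_comp; first by apply: continuous_measurable_fun; exact: continuous_cos.
  by apply: measurable_funD; [exact: mY|exact: measurable_cst].
exists (`|c| + M) => x; apply: le_trans (ler_normD _ _) _; apply: lerD => //.
by rewrite normrM ler_piMr// ler_norml cos_geN1 cos_le1.
Qed.

Lemma trig_set_preimage E : trig_set Lam E -> measurable (Y @^-1` E).
Proof.
case=> f [tf _ fE]; apply/(@measurable_indicP _ _ R).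
apply: (measurable_fun_cvg (h := fun n => f n \o Y)).
  by move=> n; have [] := trigp_comp_integrable (tf n).
by move=> x _; exact: (fE (Y x)).
Qed.

Lemma trig_set_cvg E (f : (V -> R)^nat) : (forall n, trigp Lam (f n)) ->
    (forall n x, 0 <= f n x <= 1) ->
    (forall x, f n x @[n --> \oo] --> (\1_E x : R)) ->
  (\int[P]_w ((f n (Y w))%:E))%E @[n --> \oo] --> P (Y @^-1` E).
Proof.
move=> tf f01 fE.
have mE : measurable (Y @^-1` E) by apply: trig_set_preimage; exists f.
have := @dominated_convergence _ _ _ P setT measurableT
  (fun n w => (f n (Y w))%:E) (fun w => (\1_(Y @^-1` E) w)%:E) (cst 1%E).
case.
- move=> n; apply/measurable_EFinP; by have [] := trigp_comp_integrable (tf n).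
- by apply/measurable_EFinP; apply: measurable_indic.
- apply: aeW => w _; apply: cvg_EFin; first by near=> n.
  exact: (fE (Y w)).
- apply: (@bounded_fin_integrable (fun=> 1) 1); first exact: measurable_cst.
  by move=> w; rewrite normr1.
- apply: aeW => w n _ /=; rewrite lee_fin.
  by have /andP[? ?] := f01 n (Y w); rewrite ger0_norm.
move=> _ _; rewrite integral_indic// setIT.
exact.
Unshelve. all: end_near. Qed.

Lemma trigp_measurable : measurable_fun setT (Y : T -> W).
Proof.
apply: (@measurability _ _ T W setT Y (trig_set Lam)) => //.
by move=> _ [E tE <-]; rewrite setTI; exact: trig_set_preimage.
Qed.

End one_variable.

(** The right-hand side involves only the real and imaginary parts of the expectation of
    [expi (f w)], that is, of a characteristic function. *)
Lemma integral_cos_phase (f : T -> R) (b : R) : measurable_fun setT f ->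
  (\int[P]_w (cos (f w + b))%:E)%E =
  (cos b * Rintegral P setT (cos \o f) - sin b * Rintegral P setT (sin \o f))%:E.
Proof.
move=> mf.
have ic : P.-integrable setT (EFin \o (cos \o f)).
  apply: (@bounded_fin_integrable _ 1); last first.
    by move=> w; rewrite ler_norml cos_geN1 cos_le1.
  by apply: measurableT_comp => //; apply: continuous_measurable_fun; exact: continuous_cos.
have is_ : P.-integrable setT (EFin \o (sin \o f)).
  apply: (@bounded_fin_integrable _ 1); last first.
    by move=> w; rewrite ler_norml sin_geN1 sin_le1.
  by apply: measurableT_comp => //; apply: continuous_measurable_fun; exact: continuous_sin.
under eq_integral do rewrite cosD EFinB mulrC EFinM [X in (_ - X%:E)%E]mulrC EFinM.
rewrite integralB//=; [|exact: integrableZl|exact: integrableZl].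
rewrite !integralZl// EFinB !EFinM.
by rewrite /Rintegral !fineK//; apply: integrable_fin_num.
Qed.

Variables Y Y' : T -> V.
Hypothesis mY : forall l, Lam l -> measurable_fun setT (l \o Y).
Hypothesis mY' : forall l, Lam l -> measurable_fun setT (l \o Y').
Hypothesis cfE : forall l, Lam l ->
  cexpect P (fun w => expi (l (Y w))) = cexpect P (fun w => expi (l (Y' w))).

(** By linearity only a single cosine matters, and there the characteristic functions at [l] supply
    both the cosine and the sine integral. *)
Lemma trigp_integral f : trigp Lam f ->
  (\int[P]_w (f (Y w))%:E)%E = (\int[P]_w (f (Y' w))%:E)%E.
Proof.
elim=> [//|c b l {}f ll tf ih].
have tl : trigp Lam (fun x => cos (l x + b)) by exact: trigp_cos.
have [_ h1] := trigp_comp_integrable mY tf.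
have [_ h2] := trigp_comp_integrable mY' tf.
have [_ h3] := trigp_comp_integrable mY tl.
have [_ h4] := trigp_comp_integrable mY' tl.
under [LHS]eq_integral do rewrite EFinD EFinM.
under [RHS]eq_integral do rewrite EFinD EFinM.
rewrite !integralD//=; try exact: integrableZl.
rewrite !integralZl// ih; congr (_ * _ + _)%E.
rewrite (@integral_cos_phase (l \o Y))// ?(@integral_cos_phase (l \o Y'))//; [|exact: mY'|exact: mY].
have := cfE ll; rewrite /cexpect /expi/= => -[cE sE].
by congr (_ * _ - _ * _)%:E.
Qed.

Lemma cf_trig_set E : trig_set Lam E -> P (Y @^-1` E) = P (Y' @^-1` E).
Proof.
case=> f [tf f01 fE].
have h := trig_set_cvg mY tf f01 fE.
have h' := trig_set_cvg mY' tf f01 fE.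
have hE : (fun n => \int[P]_w (f n (Y w))%:E)%E = (fun n => \int[P]_w (f n (Y' w))%:E)%E.
  by apply/funext => n; exact: trigp_integral.
by rewrite hE in h; exact: (cvg_unique _ h h').
Qed.

Let X : {mfun T >-> W} := HB.pack (Y : T -> W)
  (isMeasurableFun.Build _ _ _ _ _ (trigp_measurable mY)).
Let X' : {mfun T >-> W} := HB.pack (Y' : T -> W)
  (isMeasurableFun.Build _ _ _ _ _ (trigp_measurable mY')).

(** Two probability measures that agree on a generating pi-system containing the whole space are
    equal. *)
Lemma cf_law (E : set W) : measurable E -> distribution P X E = distribution P X' E.
Proof.
move=> mE; apply: (@measure_unique _ R W (trig_set Lam) (fun=> setT) erefl _ _ _
  (distribution P X) (distribution P X') _ _ E mE).
- exact: trig_setI.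
- by move=> _; exact: trig_setT.
- by rewrite bigcup_const//; exists 0%N.
- exact: cf_trig_set.
- by move=> _; apply: le_lt_trans (probability_le1 (distribution P X) measurableT) (ltry _).
Qed.

Lemma cf_ge0_integral (F : W -> \bar R) : measurable_fun setT F ->
  (forall x, 0 <= F x)%E ->
  (\int[P]_w F (Y w))%E = (\int[P]_w F (Y' w))%E.
Proof.
move=> mF F0; have := @ge0_integral_distribution _ _ _ _ _ P X F mF F0.
have := @ge0_integral_distribution _ _ _ _ _ P X' F mF F0 => /= <- <-.
by apply: eq_measure_integral => E mE _; exact: cf_law.
Qed.

(** Positive and negative parts are compared separately as integrals in $[0,+\infty]$, so [fine] is
    applied to the same extended real on both sides. *)
Lemma cf_Rintegral (F : W -> R) : measurable_fun setT F ->
  Rintegral P setT (fun w => F (Y w)) = Rintegral P setT (fun w => F (Y' w)).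
Proof.
move=> mF; rewrite /Rintegral integralE [in RHS]integralE; congr (fine (_ - _)%E).
- rewrite (funepos_comp (EFin \o F) Y) (funepos_comp (EFin \o F) Y') /=.
  by apply: cf_ge0_integral => //; apply: measurable_funepos; exact/measurable_EFinP.
- rewrite (funeneg_comp (EFin \o F) Y) (funeneg_comp (EFin \o F) Y') /=.
  by apply: cf_ge0_integral => //; apply: measurable_funeneg; exact/measurable_EFinP.
Qed.

End uniqueness.

(* No integrability is needed: fine sends both infinities to 0, and +oo - +oo = -oo. *)
Lemma RintegralN_total {R : realType} {d} {T : measurableType d} (P : probability T R)
  (f : T -> R) : Rintegral P setT (fun w => - f w) = - Rintegral P setT f.
Proof.
rewrite /Rintegral integralE [in RHS]integralE.
rewrite (_ : (fun w => (- f w)%:E) = \- (fun w => (f w)%:E))%E//.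
rewrite funeposN funenegN.
have := integral_ge0 (D := setT) P (fun w _ => funepos_ge0 (fun w => (f w)%:E) w).
have := integral_ge0 (D := setT) P (fun w _ => funeneg_ge0 (fun w => (f w)%:E) w).
case: (\int[P]_w _)%E => [x| |]; case: (\int[P]_w _)%E => [y| |] //= _ _;
  rewrite ?oppr0//.
by rewrite opprB.
Qed.

Local Open Scope complex_scope.

(** * Measurability of complex matrix expressions *)

Section complex_measurable.
Context {R : realType} {d} {T : measurableType d}.
Implicit Types f g : T -> R[i].

Definition cmeasurable f :=
  measurable_fun setT (fun w => complex.Re (f w)) /\
  measurable_fun setT (fun w => complex.Im (f w)).

Lemma cmeasurable_cst c : cmeasurable (fun=> c).
Proof. by split; exact: measurable_cst. Qed.

Lemma cmeasurable_real (f : T -> R) : measurable_fun setT f -> cmeasurable (fun w => (f w)%:C).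
Proof. by move=> mf; split => //=; exact: measurable_cst. Qed.

Lemma cmeasurableD f g : cmeasurable f -> cmeasurable g -> cmeasurable (fun w => f w + g w).
Proof.
move=> [fr fi] [gr gi]; split.
- rewrite (_ : (fun _ => _) = (fun w => complex.Re (f w) + complex.Re (g w))).
    exact: measurable_funD.
  by apply/funext => w; case: (f w) (g w) => ? ? [].
- rewrite (_ : (fun _ => _) = (fun w => complex.Im (f w) + complex.Im (g w))).
    exact: measurable_funD.
  by apply/funext => w; case: (f w) (g w) => ? ? [].
Qed.

Lemma cmeasurableM f g : cmeasurable f -> cmeasurable g -> cmeasurable (fun w => f w * g w).
Proof.
move=> [fr fi] [gr gi]; split.
- rewrite (_ : (fun _ => _) = (fun w => complex.Re (f w) * complex.Re (g w)
    - complex.Im (f w) * complex.Im (g w))).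
    by apply: measurable_funB; exact: measurable_funM.
  by apply/funext => w; case: (f w) (g w) => ? ? [].
- rewrite (_ : (fun _ => _) = (fun w => complex.Re (f w) * complex.Im (g w)
    + complex.Im (f w) * complex.Re (g w))).
    by apply: measurable_funD; exact: measurable_funM.
  by apply/funext => w; case: (f w) (g w) => ? ? [].
Qed.

Lemma cmeasurableN f : cmeasurable f -> cmeasurable (fun w => - f w).
Proof.
move=> mf; under eq_fun do rewrite -mulN1r.
by apply: cmeasurableM => //; exact: cmeasurable_cst.
Qed.

Lemma cmeasurable_conj f : cmeasurable f -> cmeasurable (fun w => conjc (f w)).
Proof.
move=> [fr fi]; split.
- rewrite (_ : (fun _ => _) = (fun w => complex.Re (f w)))//.
  by apply/funext => w; case: (f w).
- rewrite (_ : (fun _ => _) = (fun w => - complex.Im (f w))).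
    exact: measurableT_comp.
  by apply/funext => w; case: (f w).
Qed.

Lemma cmeasurableV f : cmeasurable f -> cmeasurable (fun w => (f w)^-1).
Proof.
move=> [fr fi].
pose n2 w := complex.Re (f w) ^+ 2 + complex.Im (f w) ^+ 2.
have mn : measurable_fun setT (fun w => (n2 w)^-1).
  (* The reciprocal inherits measurability from the real power with exponent $-1$; both take the
     value 0 at 0. *)
  rewrite (_ : (fun _ => _) = (fun w => n2 w `^ (-1))).
    apply: measurableT_comp (measurable_powR _) _.
    by apply: measurable_funD; exact: measurable_funX.
  by apply/funext => w; rewrite powR_inv1// addr_ge0 ?sqr_ge0.
split.
- rewrite (_ : (fun _ => _) = (fun w => complex.Re (f w) * (n2 w)^-1)).
    exact: measurable_funM.
  by apply/funext => w; rewrite /n2; case: (f w).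
- rewrite (_ : (fun _ => _) = (fun w => - (complex.Im (f w) * (n2 w)^-1))).
    by apply: measurableT_comp => //; exact: measurable_funM.
  by apply/funext => w; rewrite /n2; case: (f w).
Qed.

Lemma cmeasurable_sum (I : Type) (r : seq I) (f : I -> T -> R[i]) :
  (forall i, cmeasurable (f i)) -> cmeasurable (fun w => \sum_(i <- r) f i w).
Proof.
move=> mf; elim: r => [|i r ih].
  by under eq_fun do rewrite big_nil; exact: cmeasurable_cst.
by under eq_fun do rewrite big_cons; exact: cmeasurableD.
Qed.

Definition mxmeasurable m n (F : T -> 'M[R[i]]_(m, n)) :=
  forall i j, cmeasurable (fun w => F w i j).

Lemma mxmeasurable_cst m n (A : 'M[R[i]]_(m, n)) : mxmeasurable (fun=> A).
Proof. by move=> i j; exact: cmeasurable_cst. Qed.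

Lemma mxmeasurableD m n (F G : T -> 'M[R[i]]_(m, n)) :
  mxmeasurable F -> mxmeasurable G -> mxmeasurable (fun w => F w + G w).
Proof. by move=> mF mG i j; under eq_fun do rewrite mxE; exact: cmeasurableD. Qed.

Lemma mxmeasurableN m n (F : T -> 'M[R[i]]_(m, n)) :
  mxmeasurable F -> mxmeasurable (fun w => - F w).
Proof. by move=> mF i j; under eq_fun do rewrite mxE; exact: cmeasurableN. Qed.

Lemma mxmeasurableZ m n (f : T -> R[i]) (F : T -> 'M[R[i]]_(m, n)) :
  cmeasurable f -> mxmeasurable F -> mxmeasurable (fun w => f w *: F w).
Proof. by move=> mf mF i j; under eq_fun do rewrite mxE; exact: cmeasurableM. Qed.

Lemma mxmeasurableM m n p (F : T -> 'M[R[i]]_(m, n)) (G : T -> 'M[R[i]]_(n, p)) :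
  mxmeasurable F -> mxmeasurable G -> mxmeasurable (fun w => F w *m G w).
Proof.
move=> mF mG i j; under eq_fun do rewrite mxE.
by apply: cmeasurable_sum => k; exact: cmeasurableM.
Qed.

Lemma mxmeasurable_conjT m n (F : T -> 'M[R[i]]_(m, n)) :
  mxmeasurable F -> mxmeasurable (fun w => conjT (F w)).
Proof. by move=> mF i j; under eq_fun do rewrite !mxE; exact: cmeasurable_conj. Qed.

Lemma mxmeasurable_mmse n eps (C S : 'M[R[i]]_n) (X : T -> 'cV[R[i]]_n) :
  mxmeasurable X -> mxmeasurable (fun w => mmse_denoiser eps C S (X w)).
Proof.
move=> mX; apply: mxmeasurableZ.
  apply/cmeasurableV/cmeasurableD; first exact: cmeasurable_cst.
  apply: cmeasurableM; first exact: cmeasurable_cst.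
  apply: cmeasurable_real; apply: measurableT_comp => //; apply: measurableT_comp => //.
  by have [] := mxmeasurableM (mxmeasurableM (mxmeasurable_conjT mX)
    (mxmeasurable_cst (invmx S - invmx (C + S)))) mX 0 0.
by apply: mxmeasurableM => //; exact: mxmeasurable_cst.
Qed.

End complex_measurable.

(** * Conjugate transpose and the real pairing *)

Section conjT.
Context {R : rcfType}.

Lemma conjTM m n p (A : 'M[R[i]]_(m, n)) (B : 'M[R[i]]_(n, p)) :
  conjT (A *m B) = conjT B *m conjT A.
Proof. by rewrite /conjT map_mxM trmx_mul. Qed.

Lemma conjTD m n (A B : 'M[R[i]]_(m, n)) : conjT (A + B) = conjT A + conjT B.
Proof. by rewrite /conjT map_mxD linearD. Qed.

Lemma rpairDl n (u v x : 'cV[R[i]]_n) : rpair (u + v) x = rpair u x + rpair v x.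
Proof. by rewrite /rpair conjTD mulmxDl mxE; case: (_ 0 0) (_ 0 0) => ? ? []. Qed.

Lemma rpairZl n (r : R) (u x : 'cV[R[i]]_n) : rpair (r%:C *: u) x = r * rpair u x.
Proof.
rewrite /rpair (_ : conjT _ = r%:C *: conjT u).
  by rewrite -scalemxAl mxE; case: (_ 0 0) => ? ? /=; rewrite mul0r subr0.
by apply/matrixP => i j; rewrite !mxE rmorphM/= oppr0.
Qed.

Lemma rpair0l n (x : 'cV[R[i]]_n) : rpair 0 x = 0.
Proof. by rewrite -(scale0r 0) -[0 *: _]/(0%:C *: _) rpairZl mul0r. Qed.

(** For [c] equal to 1 and to ['i] this yields the real and the imaginary part of a coordinate, so
    the pairings determine the vector. *)
Lemma rpair_delta n (c : R[i]) (i : 'I_n) (x : 'cV[R[i]]_n) :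
  rpair (c *: delta_mx i 0) x = complex.Re (conjc c * x i 0).
Proof.
rewrite /rpair mxE (bigD1 i)//= big1 ?addr0 ?mxE ?eqxx ?mulr1//.
by move=> j ji; rewrite !mxE (negbTE ji) mulr0 conjc0 mul0r.
Qed.

End conjT.

(** * Sign flips *)

Section flip_equivariance.
Context {R : realType} {n : nat}.
Variable D : 'M[R[i]]_n.
Hypothesis DH : conjT D = D.
Hypothesis DD : D *m D = 1%:M.

Lemma conjT_flip m (u : 'M[R[i]]_(n, m)) : conjT (D *m u) = conjT u *m D.
Proof. by rewrite conjTM DH. Qed.

Lemma rpair_flip (u x : 'cV[R[i]]_n) : rpair u (D *m x) = rpair (D *m u) x.
Proof. by rewrite /rpair conjT_flip mulmxA. Qed.

(** A Hermitian involution commuting with [A] satisfies $D^H A D=A D^2=A$. *)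
Lemma quad_flip (A : 'M[R[i]]_n) (u : 'cV[R[i]]_n) : comm_mx D A ->
  conjT (D *m u) *m A *m (D *m u) = conjT u *m A *m u.
Proof.
move=> DA; rewrite conjT_flip -!mulmxA (mulmxA A) -DA.
by rewrite -!mulmxA (mulmxA D D) DD mul1mx.
Qed.

Lemma cgauss_cf_flip (A : 'M[R[i]]_n) (u : 'cV[R[i]]_n) : comm_mx D A ->
  cgauss_cf A (D *m u) = cgauss_cf A u.
Proof. by move=> DA; rewrite /cgauss_cf quad_flip. Qed.

Lemma comm_invmx (A : 'M[R[i]]_n) : comm_mx D A -> comm_mx D (invmx A).
Proof.
(* On a singular matrix [invmx] returns its argument, so commutation holds there by assumption. *)
move=> DA; rewrite /comm_mx; have [uA|uA] := boolP (A \in unitmx); last first.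
  by rewrite /invmx (negbTE uA).
rewrite -[LHS](mulKmx uA) (mulmxA A) -DA -(mulmxA D) mulmxV//.
by rewrite mulmx1.
Qed.

(** The scalar weight depends on [xi] only through a quadratic form invariant under [D], and the
    linear factor $C(C+S)^{-1}$ commutes with [D]. *)
Lemma mmse_flip eps (C S : 'M[R[i]]_n) xi : comm_mx D C -> comm_mx D S ->
  mmse_denoiser eps C S (D *m xi) = D *m mmse_denoiser eps C S xi.
Proof.
move=> DC DS; rewrite /mmse_denoiser.
have DCS : comm_mx D (C + S) by exact: comm_mxD.
rewrite quad_flip; last by apply: comm_mxB; exact: comm_invmx.
rewrite -scalemxAr; congr (_ *: _).
rewrite !mulmxA; congr (_ *m _).
by rewrite -mulmxA -(comm_invmx DCS) !mulmxA DC.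
Qed.

(** Joint values of $(a_n,\mathbf h_n,\mathbf v^t)$. The type is made pointed for the uniqueness
    results, and its sigma-algebra will be the one generated by [trig_set pairings]. *)
Definition gvec := (R * 'cV[R[i]]_n * 'cV[R[i]]_n)%type.
HB.instance Definition _ := Choice.on gvec.
HB.instance Definition _ := isPointed.Build gvec (0, 0, 0).

(** These are the real-linear functionals of the triple, exactly the phases at which the joint
    characteristic function is prescribed. *)
Definition pairings : set (gvec -> R) := [set f | exists s u w,
  f = fun x => s * x.1.1 + rpair u x.1.2 + rpair w x.2].

Lemma pairings0 : pairings (fun=> 0).
Proof.
by exists 0, 0, 0; apply/funext => x; rewrite !rpair0l mul0r !addr0.
Qed.

Lemma pairings_comb (r : R) f g : pairings f -> pairings g ->
  pairings (fun x => r * f x + g x).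
Proof.
move=> [s [u [w ->]]] [s' [u' [w' ->]]].
exists (r * s + s'), (r%:C *: u + u'), (r%:C *: w + w'); apply/funext => x.
by rewrite !rpairDl !rpairZl; ring.
Qed.

Definition estimation_error eps (C S : 'M[R[i]]_n) (x : gvec) :=
  mmse_denoiser eps C S (x.1.1%:C *: x.1.2 + x.2) - x.1.1%:C *: x.1.2.

Definition flip (x : gvec) : gvec := (x.1.1, D *m x.1.2, D *m x.2).

Lemma estimation_error_flip eps (C S : 'M[R[i]]_n) x : comm_mx D C -> comm_mx D S ->
  estimation_error eps C S (flip x) = D *m estimation_error eps C S x.
Proof.
move=> DC DS; rewrite /estimation_error /= !scalemxAr -!mulmxDr mmse_flip//.
by rewrite mulmxBr.
Qed.

Local Notation W := (g_sigma_algebraType (trig_set pairings)).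

Lemma pairing_measurable s u w :
  measurable_fun setT ((fun x => s * x.1.1 + rpair u x.1.2 + rpair w x.2) : W -> R).
Proof.
by apply: lam_measurable; [exact: pairings0|exact: pairings_comb|exists s, u, w].
Qed.

(** Measurability is with respect to the sigma-algebra on which the law has been identified: real
    and imaginary parts of the coordinates are pairings, and the error is an algebraic and
    exponential expression in them. *)
Lemma estimation_error_measurable eps (C S : 'M[R[i]]_n) :
  mxmeasurable (estimation_error eps C S : W -> _).
Proof.
have ma : measurable_fun setT ((fun x => x.1.1) : W -> R).
  rewrite (_ : (fun _ => _) = (fun x => 1 * x.1.1 + rpair 0 x.1.2 + rpair 0 x.2)).
    exact: pairing_measurable.
  by apply/funext => x; rewrite !rpair0l !addr0 mul1r.
have mh : mxmeasurable ((fun x => x.1.2) : W -> _).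
  move=> i j; rewrite ord1; split.
    rewrite (_ : (fun _ => _) = (fun x => 0 * x.1.1 + rpair (1 *: delta_mx i 0) x.1.2 + rpair 0 x.2)).
      exact: pairing_measurable.
    by apply/funext => x; rewrite rpair_delta rpair0l addr0 mul0r add0r conjc1 mul1r.
  rewrite (_ : (fun _ => _) = (fun x => 0 * x.1.1 + rpair ('i *: delta_mx i 0) x.1.2 + rpair 0 x.2)).
    exact: pairing_measurable.
  apply/funext => x; rewrite rpair_delta rpair0l addr0 mul0r add0r.
  by case: (x.1.2 i 0) => p q /=; ring.
have mv : mxmeasurable ((fun x => x.2) : W -> _).
  move=> i j; rewrite ord1; split.
    rewrite (_ : (fun _ => _) = (fun x => 0 * x.1.1 + rpair 0 x.1.2 + rpair (1 *: delta_mx i 0) x.2)).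
      exact: pairing_measurable.
    by apply/funext => x; rewrite rpair_delta rpair0l addr0 mul0r add0r conjc1 mul1r.
  rewrite (_ : (fun _ => _) = (fun x => 0 * x.1.1 + rpair 0 x.1.2 + rpair ('i *: delta_mx i 0) x.2)).
    exact: pairing_measurable.
  apply/funext => x; rewrite rpair_delta rpair0l addr0 mul0r add0r.
  by case: (x.2 i 0) => p q /=; ring.
have mah : mxmeasurable ((fun x => x.1.1%:C *: x.1.2) : W -> _).
  by apply: mxmeasurableZ => //; exact: cmeasurable_real.
apply: mxmeasurableD; last exact: mxmeasurableN.
by apply: mxmeasurable_mmse; exact: mxmeasurableD.
Qed.

Section law.
Context {d} {T : measurableType d} (P : probability T R).
Variables (eps : R) (C S : 'M[R[i]]_n).
Hypotheses (DC : comm_mx D C) (DS : comm_mx D S).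
Variables (a : T -> R) (h v : T -> 'cV[R[i]]_n).
Hypotheses (ma : measurable_fun setT a) (mh : cvec_measurable h) (mv : cvec_measurable v).
Hypothesis law : forall s (u w : 'cV[R[i]]_n),
  cexpect P (fun om => expi (s * a om + rpair u (h om) + rpair w (v om)))
  = bern_cf eps s * cgauss_cf C u * cgauss_cf S w.

Let Y om : gvec := (a om, h om, v om).

Let mY l : pairings l -> measurable_fun setT (l \o Y).
Proof.
have mrpair u (x : T -> 'cV[R[i]]_n) : cvec_measurable x ->
    measurable_fun setT (fun om => rpair u (x om)).
  move=> mx; have mx' : mxmeasurable x by move=> i j; rewrite ord1; exact: mx.
  by have [] := mxmeasurableM (mxmeasurable_cst (conjT u)) mx' 0 0.
move=> [s [u [w ->]]]; apply: measurable_funD; last exact: mrpair.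
apply: measurable_funD; last exact: mrpair.
by apply: measurable_funM => //; exact: measurable_cst.
Qed.

Let mY' l : pairings l -> measurable_fun setT (l \o (flip \o Y)).
Proof.
move=> [s [u [w ->]]].
rewrite (_ : _ \o _ = (fun x => s * x.1.1 + rpair (D *m u) x.1.2 + rpair (D *m w) x.2) \o Y).
  by apply: mY; do 3 eexists.
by apply/funext => om /=; rewrite !rpair_flip.
Qed.

(** Moving [D] across the pairing replaces [u] and [w] by [D *m u] and [D *m w], which leaves both
    Gaussian factors unchanged; the Bernoulli factor is untouched. *)
Lemma cf_flip l : pairings l ->
  cexpect P (fun w => expi (l (Y w))) = cexpect P (fun w => expi (l ((flip \o Y) w))).
Proof.
move=> [s [u [w ->]]] /=; rewrite law.
under eq_fun do rewrite !rpair_flip.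
by rewrite law !cgauss_cf_flip.
Qed.

Lemma cexpect_flip (F : gvec -> R[i]) : cmeasurable (F : W -> R[i]) ->
  cexpect P (fun om => F (flip (Y om))) = cexpect P (fun om => F (Y om)).
Proof.
move=> [Fr Fi]; congr (_ +i* _); apply/esym.
- exact: (cf_Rintegral pairings0 pairings_comb mY mY' cf_flip Fr).
- exact: (cf_Rintegral pairings0 pairings_comb mY mY' cf_flip Fi).
Qed.

(** At an entry negated by conjugation with [D], the error product changes sign under [flip] while
    the law does not, so the expected entry equals its own negative. *)
Lemma mexpect_error_flip :
  let E := mexpect P (fun om => estimation_error eps C S (Y om) *m
                                conjT (estimation_error eps C S (Y om))) in
  forall i j, (forall u : 'M[R[i]]_n, (D *m u *m D) i j = - u i j) -> E i j = 0.
Proof.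
move=> E i j Dij; rewrite mxE.
pose F x := (estimation_error eps C S x *m conjT (estimation_error eps C S x)) i j.
have mF : cmeasurable (F : W -> R[i]).
  apply: mxmeasurableM; first exact: estimation_error_measurable.
  by apply: mxmeasurable_conjT; exact: estimation_error_measurable.
have FN x : F (flip x) = - F x.
  by rewrite /F estimation_error_flip// conjT_flip mulmxA -(mulmxA D) Dij.
have := cexpect_flip mF; under eq_fun do rewrite FN.
rewrite -/F /cexpect => -[].
have -> : (fun w => complex.Re (- F (Y w))) = (fun w => - complex.Re (F (Y w))).
  by apply/funext => w; case: (F _).
have -> : (fun w => complex.Im (- F (Y w))) = (fun w => - complex.Im (F (Y w))).
  by apply/funext => w; case: (F _).
rewrite !RintegralN_total => hr hi.
by apply/eqP; rewrite eq_complex/=; apply/andP; split; apply/eqP; lra.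
Qed.

End law.
End flip_equivariance.

(** * Block-diagonal matrices and block sign flips *)

Section blocks.
Context {K M : nat}.

Definition block_diagonal {A : pzRingType} (B : 'M[A]_(K * M)) :=
  forall i j, blk i != blk j -> B i j = 0.

Lemma bdiag_block_diagonal (A : pzRingType) (B : 'I_K -> 'M[A]_M) :
  block_diagonal (bdiag B).
Proof. by move=> i j ij; rewrite mxE (negbTE ij). Qed.

(** Block [k] is read off at the flat indices $kM+p$; Euclidean division by $M$ recovers each index
    from its block and offset. *)
Lemma block_diagonalP (A : pzRingType) (B : 'M[A]_(K * M)) :
  block_diagonal B -> exists S, B = bdiag S.
Proof.
have lt (k : 'I_K) (p : 'I_M) : (k * M + p < K * M)%N.
  apply: (@leq_trans (k.+1 * M)); first by rewrite mulSn addnC ltn_add2r.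
  by rewrite leq_mul2r ltn_ord orbT.
move=> B0; exists (fun k => \matrix_(p, q) B (Ordinal (lt k p)) (Ordinal (lt k q))).
apply/matrixP => i j; rewrite !mxE; case: eqP => [[ij]|/eqP/B0//].
by congr (B _ _); apply/val_inj; rewrite /= -?divn_eq// ij -divn_eq.
Qed.

Variables (R : realType) (k : 'I_K).

(** Conjugation by this matrix multiplies entry $(i,j)$ by the signs of both indices, so exactly the
    entries coupling block [k] to another block change sign. *)
Definition block_flip : 'M[R[i]]_(K * M) := diag_mx (\row_j (-1) ^+ (blk j == k)).

Lemma block_flip_mulE (A : 'M[R[i]]_(K * M)) i j :
  (block_flip *m A) i j = (-1) ^+ (blk i == k) * A i j.
Proof. by rewrite mul_diag_mx !mxE. Qed.

Lemma mul_block_flipE (A : 'M[R[i]]_(K * M)) i j :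
  (A *m block_flip) i j = A i j * (-1) ^+ (blk j == k).
Proof. by rewrite mul_mx_diag !mxE. Qed.

Lemma block_flipK : block_flip *m block_flip = 1%:M.
Proof.
apply/matrixP => i j; rewrite block_flip_mulE !mxE.
by have [->|_] := eqVneq i j; rewrite ?mulr0// mulr1n -signr_addb addbb.
Qed.

Lemma conjT_block_flip : conjT block_flip = block_flip.
Proof.
apply/matrixP => i j; rewrite !mxE [j == i]eq_sym.
have [->|_] := eqVneq i j; last by rewrite conjc0.
by rewrite !mulr1n rmorph_sign.
Qed.

(** Left and right multiplication use the signs of row and column; these agree within a block, and
    other entries vanish. *)
Lemma comm_block_flip (A : 'M[R[i]]_(K * M)) : block_diagonal A -> comm_mx block_flip A.
Proof.
move=> A0; apply/matrixP => i j; rewrite block_flip_mulE mul_block_flipE mulrC.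
by have [->//|/A0->] := eqVneq (blk i) (blk j); rewrite !mul0r.
Qed.

End blocks.

Unset Implicit Arguments.
Theorem theorem1 (R : realType) (d : measure_display) (T : measurableType d)
  (P : probability T R)
  (K M N L : nat) (hK : (0 < K)%N) (hM : (0 < M)%N) (hN : (0 < N)%N) (hL : (0 < L)%N)
  (sigma2 : R) (hsigma : 0 < sigma2)
  (eps : 'I_N -> R) (heps : forall n, 0 < eps n < 1)
  (Rb : 'I_N -> 'I_K -> 'M[R[i]]_M) (hRb : forall n k, psd (Rb n k))
  (a : 'I_N -> T -> R) (h : 'I_N -> T -> 'cV[R[i]]_(K * M))
  (v : nat -> T -> 'cV[R[i]]_(K * M))
  (Sigma : nat -> 'M[R[i]]_(K * M))
  (ha_meas : forall n, measurable_fun setT (a n))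
  (hh_meas : forall n, cvec_measurable (h n))
  (hv_meas : forall t, cvec_measurable (v t))
  (* a_n ~ Bernoulli(eps_n), h_n ~ CN(0, R_n), v^t ~ CN(0, Sigma^t),
     mutually independent (joint characteristic function factorizes) *)
  (hlaw : forall (t : nat) (n : 'I_N) (s : R) (u w : 'cV[R[i]]_(K * M)),
     cexpect P (fun om => expi (s * a n om + rpair u (h n om) + rpair w (v t om)))
     = bern_cf (eps n) s * cgauss_cf (bdiag (Rb n)) u * cgauss_cf (Sigma t) w)
  (hSigma0 : Sigma 0%N = (sigma2%:C)%:M + (L%:R)^-1 *: \sum_(n < N) bdiag (Rb n))
  (hSigmaS : forall t : nat,
     Sigma t.+1 = (sigma2%:C)%:M + (L%:R)^-1 *: \sum_(n < N)
       mexpect P (fun om =>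
         let x := (a n om)%:C *: h n om in
         let e := mmse_denoiser (eps n) (bdiag (Rb n)) (Sigma t) (x + v t om) - x in
         e *m conjT e)) :
  forall t : nat, exists S : 'I_K -> 'M[R[i]]_M, Sigma t = bdiag S.
Proof.
move=> t; apply: block_diagonalP.
(* The initial value and the recursion share this affine shape, so only the summands remain to be
   treated. *)
have bd_affine (X : 'I_N -> 'M[R[i]]_(K * M)) : (forall n, block_diagonal (X n)) ->
    block_diagonal ((sigma2%:C)%:M + (L%:R)^-1 *: \sum_(n < N) X n).
  move=> X0 i j ij; rewrite !mxE summxE big1 ?mulr0 ?addr0 => [|n _]; last exact: X0.
  by have [ij'|//] := eqVneq i j; rewrite ij' eqxx in ij.
elim: t => [|t ih].
  by rewrite hSigma0; apply: bd_affine => n; exact: bdiag_block_diagonal.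
rewrite hSigmaS; apply: bd_affine => n i j ij.
(* Flipping the block of row [i] negates entry $(i,j)$, since [j] lies in another block. *)
pose D : 'M[R[i]]_(K * M) := block_flip R (blk i).
have DR : comm_mx D (bdiag (Rb n)).
  by apply: comm_block_flip; exact: bdiag_block_diagonal.
have DS : comm_mx D (Sigma t) by exact: comm_block_flip.
(* The error in the recursion is convertible to [estimation_error] at the triple $(a_n,\mathbf
   h_n,\mathbf v^t)$. *)
apply: (mexpect_error_flip (conjT_block_flip _ _) (block_flipK _ _) DR DS
  (ha_meas n) (hh_meas n) (hv_meas t) (hlaw t n)) => A.
by rewrite mul_block_flipE block_flip_mulE eqxx eq_sym (negbTE ij) mulr1 mulN1r.
Qed.
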